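(* Let $F(x)=\sum_{(i,j)\in\mathcal E}f_{i,j}(x_i,x_j)$ be a sum of bivariates on $\Omega=\Omega_1\times\dots\times\Omega_n$ and let $\varepsilon>0$. Consider the dual entropy-regularized tree relaxation: maximize $$\Big(\sum_{i\in\mathcal V}\rho_i\Big)-\varepsilon\sum_{(i,j)\in\mathcal E}\ \sum_{x_i\in\Omega_i,\,x_j\in\Omega_j}\exp\Big(\frac{\rho_{i,j}(x_i)+\rho_{j,i}(x_j)-f_{i,j}(x_i,x_j)}{\varepsilon}-1\Big)$$ over $\rho_i\in\mathbb R$ ($i\in\mathcal V$) and $\rho_{i,j}\in\mathbb R^{\Omega_i}$ ($i\in\mathcal V$, $j\in\widetilde{\mathcal N}(i)$), subject to $\sum_{j\in\widetilde{\mathcal N}(i)}\rho_{i,j}(x_i)=\rho_i$ for all $x_i\in\Omega_i$, $i\in\mathcal V$. Then the objective value of a block coordinate ascent with respect to the blocks $\big(\rho_i,(\rho_{i,j})_{j\in\widetilde{\mathcal N}(i)}\big)$, $i\in\mathcal V$, converges to the global maximal value of this problem.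
   Context: $\mathcal V=\{1,\dots,n\}$, $\mathcal E\subseteq\{(i,j)\in\mathcal V\times\mathcal V:i<j\}$, $\Omega_1,\dots,\Omega_n$ finite nonempty sets, $f_{i,j}:\Omega_i\times\Omega_j\to\mathbb R$; $\widetilde{\mathcal N}(i)=\{j\in\mathcal V:(i,j)\in\mathcal E\text{ or }(j,i)\in\mathcal E\}$. Block coordinate ascent: start from any feasible point; loop repeatedly through the vertices $i\in\mathcal V$ in a fixed order; at vertex $i$ replace the block $\big(\rho_i,(\rho_{i,j})_{j\in\widetilde{\mathcal N}(i)}\big)$ by a maximizer of the objective over that block subject to its constraint, with all other blocks kept at their current values. *)

(* Defs.v *)
From HB Require Import structures.
From mathcomp Require Import all_boot all_order all_algebra all_fingroup.
From mathcomp Require Import all_classical all_reals all_analysis.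

Set Implicit Arguments.
Unset Strict Implicit.
Unset Printing Implicit Defensive.

Import Order.TTheory GRing.Theory Num.Theory.
Import numFieldNormedType.Exports.

Local Open Scope ring_scope.

(* The edge set is oriented (an edge is stored once, as a pair (i, j) with
   i < j), whereas neighbourhoods forget the orientation. *)
Definition nbr (n : nat) (E : {set 'I_n * 'I_n}) (i : 'I_n) : {set 'I_n} :=
  [set j | ((i, j) \in E) || ((j, i) \in E)].

(* [rho_e p i j] is meaningful only for j \in nbr E i.  The remaining entries
   are dummies: no definition below depends on them. *)
Record dual_point (R : realType) (n : nat) (Omega : 'I_n -> finType) := DualPoint {
  rho_v : 'I_n -> R;
  rho_e : forall i : 'I_n, 'I_n -> Omega i -> R
}.
Arguments rho_e {R n Omega} d i j _ : rename.

Section DualProblem.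
Variables (R : realType) (n : nat) (Omega : 'I_n -> finType).
Variables (E : {set 'I_n * 'I_n}).
Variables (f : forall i j : 'I_n, Omega i -> Omega j -> R) (eps : R).

Implicit Types (p q : dual_point R Omega) (i : 'I_n).

Definition objective p : R :=
  (\sum_(i < n) rho_v p i) -
  eps * \sum_(e in E) \sum_(x : Omega e.1) \sum_(y : Omega e.2)
    expR ((rho_e p e.1 e.2 x + rho_e p e.2 e.1 y - @f e.1 e.2 x y) / eps - 1).

Definition block_constraint p i : Prop :=
  forall x : Omega i, \sum_(j in nbr E i) rho_e p i j x = rho_v p i.

Definition feasible p : Prop := forall i, block_constraint p i.

Definition is_maximal_value (M : R) : Prop :=
  (exists2 p, feasible p & objective p = M) /\
  (forall p, feasible p -> objective p <= M).

Definition same_off_block i p q : Prop :=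
  forall k : 'I_n, k != i ->
    rho_v q k = rho_v p k /\
    (forall j : 'I_n, j \in nbr E k ->
       forall x : Omega k, rho_e q k j x = rho_e p k j x).

(* The maximizer is not required to be unique, so this is a relation. *)
Definition block_update i p q : Prop :=
  [/\ same_off_block i p q,
      block_constraint q i &
      forall q', same_off_block i p q' -> block_constraint q' i ->
        objective q' <= objective q].

(* [p t] is the point reached after t block updates; the vertices are visited
   in the order order 0, ..., order (n - 1), over and over again. *)
Definition block_coordinate_ascent (order : {perm 'I_n})
    (p : nat -> dual_point R Omega) : Prop :=
  feasible (p 0%N) /\
  forall (s : nat) (k : 'I_n),
    block_update (order k) (p (s * n + k)%N) (p (s * n + k).+1).

End DualProblem.

(* Main.v *)
Require Import Defs.
From HB Require Import structures.
From mathcomp Require Import all_boot all_order all_algebra all_fingroup.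
From mathcomp Require Import all_classical all_reals all_analysis.
From mathcomp Require Import ring lra.

Set Implicit Arguments.
Unset Strict Implicit.
Unset Printing Implicit Defensive.

Import Order.TTheory GRing.Theory Num.Theory.
Import numFieldNormedType.Exports.

Local Open Scope classical_set_scope.
Local Open Scope ring_scope.

(** On feasible points the objective depends only on the edge potentials
    [v_e(x, y) = (rho_ij(x) + rho_ji(y)) / eps], [e = (i, j)]: summing the
    constraints along one configuration [x] gives
    [sum_i rho_i = eps * sum_e v_e(x_i, x_j)].  So the problem is to maximize
    a function [D(u) = sum_k (b_k u_k - c_k exp u_k)] with [c_k >= 0] on a
    linear subspace [W] of a finite-dimensional space, by exact maximization
    along subspaces [Wb i] that together span [W] ([objectiveE]).

    Superlevel sets of [D] on [W] are bounded: [b] may be computed from a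
    configuration through any prescribed pair of labels, all summands of [D]
    are bounded above, and [v - exp (v - g)] tends to [-oo] at both ends
    ([potential_bounded]).

    Convergence for such a [D] ([block_ascent_cvg]) rests on the vector
    [q_k = c_k exp u_k], which is the gradient of the exponential part.  After
    an update of block [i], [b] and [q] agree as linear forms on [Wb i]; hence
    an update gains at least
    [sum_k c_k (exp (u_k / 2) - exp (u'_k / 2))^2] ([expsum_gain]).  As [D] is
    nondecreasing and bounded along the iterates, the gains tend to [0], so
    the change of [q] over any bounded number of updates tends to [0].  Let
    [z] be the limit of the bounded iterates along an ultrafilter refining
    [\oo]; it lies in [W], a subspace of a finite-dimensional space being
    given by linear equations ([lin_closed_ker]).  Every block is updated
    within a bounded number of steps, so the limit of [q] agrees with [b] on
    all the [Wb i], hence on [W].  By concavity [z] is a global maximizer;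
    in particular the maximum is attained, and the monotone sequence of
    objective values converges to it. *)

(** * Subspaces of finite-dimensional spaces *)

(** [W] is a linear subspace of the space of functions [K -> R]. *)
Definition lin_closed (R : pzRingType) (K : Type) (W : set (K -> R)) : Prop :=
  W (fun=> 0) /\
  forall a u v, W u -> W v -> W (fun k => a * u k + v k).

(** A subspace given by an arbitrary predicate is the row space of a matrix [A]
    of maximal rank among those with rows in it, hence the kernel of the
    cokernel matrix of [A]. *)
Lemma row_subspace_ker (F : fieldType) (m : nat) (W : set 'rV[F]_m) :
  W 0 -> (forall a u v, W u -> W v -> W (a *: u + v)) ->
  exists C : 'M[F]_m, forall u, W u <-> u *m C = 0.
Proof.
move=> W0 Wlin.
pose P r := `[< exists2 A : 'M[F]_m, (forall i, W (row i A)) & \rank A = r >].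
have P_ex : exists r, P r.
  exists 0%N; apply/asboolP; exists 0; last exact: mxrank0.
  by move=> i; rewrite row0.
have P_le r : P r -> (r <= m)%N.
  by move=> /asboolP[A _ <-]; exact: rank_leq_row.
case: (ex_maxnP P_ex P_le) => r /asboolP[A WA rA] r_max.
have W_sub (u : 'rV_m) : (u <= A)%MS -> W u.
  move=> /submxP[c ->]; rewrite mulmx_sum_row.
  elim/big_ind : _ => // [u1 u2 W1 W2|i _].
  - by rewrite -[u1]scale1r; exact: Wlin.
  - by rewrite -[_ *: _]addr0; exact: Wlin.
exists (cokermx A) => u; split; last first.
  by move=> uA; apply: W_sub; rewrite submxE uA.
move=> Wu; apply/eqP; rewrite -submxE.
(* By maximality of the rank of A, adjoining the row u does not increase it. *)
have WB i : W (row i (A + u)%MS).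
  have /sub_addsmxP[[c d] /= ->] : (row i (A + u)%MS <= A + u)%MS.
    exact: row_sub.
  rewrite addrC [d]mx11_scalar mul_scalar_mx.
  by apply: Wlin => //; apply: W_sub; exact: submxMl.
have rB : (\rank (A + u)%MS <= \rank A)%N.
  by rewrite rA; apply: r_max; apply/asboolP; exists (A + u)%MS.
have AB : (A <= A + u)%MS by exact: addsmxSl.
have := mxrank_leqif_sup AB => -[rAB /esym].
by rewrite eqn_leq rAB rB => /(submx_trans (addsmxSr A u)).
Qed.

(** A subspace of [K -> F], with [K] finite, is defined by finitely many linear
    equations; for the reals this makes it closed under pointwise limits. *)
Lemma lin_closed_ker (F : fieldType) (K : finType) (W : set (K -> F)) :
  lin_closed W ->
  exists C : 'I_#|K| -> K -> F,
    forall u, W u <-> forall l, \sum_k u k * C l k = 0.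
Proof.
move=> [W0 Wlin].
pose fn (r : 'rV[F]_#|K|) := fun k => r 0 (enum_rank k).
have [||C CP] := @row_subspace_ker F #|K| [set r | W (fn r)].
- rewrite /= (_ : fn 0 = fun=> 0) //; apply/funext => k.
  by rewrite /fn mxE.
- move=> a u v Wu Wv.
  rewrite /= (_ : fn _ = fun k => a * fn u k + fn v k); first exact: Wlin.
  by apply/funext => k; rewrite /fn !mxE.
exists (fun l k => C (enum_rank k) l) => u.
pose r : 'rV[F]_#|K| := \row_j u (enum_val j).
have fnr : fn r = u by apply/funext => k; rewrite /fn mxE enum_rankK.
have -> : W u <-> r *m C = 0 by rewrite -CP /= fnr.
have rC l : (r *m C) 0 l = \sum_k u k * C (enum_rank k) l.
  rewrite mxE (reindex _ (onW_bij _ (@enum_rank_bij K))).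
  by apply: eq_bigr => k _; rewrite mxE enum_rankK.
split=> [C0 l|C0]; first by rewrite -rC C0 mxE.
by apply/rowP => l; rewrite rC C0 mxE.
Qed.

(** * Sums of exponentials *)

Lemma cvg_fin_sum (R : realType) (K : finType) (T : Type) (F : set_system T)
    {FF : Filter F} (f : K -> T -> R) (l : K -> R) :
  (forall k, f k x @[x --> F] --> l k) ->
  \sum_k f k x @[x --> F] --> \sum_k l k.
Proof. by move=> fl; apply: cvg_big => // x; exact: add_continuous. Qed.

(** First-order condition at [tau = 0], where both sides of the inequality
    vanish: their derivatives there agree. *)
Lemma expR_sum_stationary (R : realType) (K : finType) (q a : K -> R) (d : R) :
  (forall k, 0 <= q k) ->
  (forall tau, tau * d <= \sum_k q k * (expR (tau * a k) - 1)) ->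
  d = \sum_k q k * a k.
Proof.
move=> q_ge0.
(* The reverse inequality follows from this one on replacing tau by - tau. *)
suff le_der (e : R) (b : K -> R) :
    (forall tau, tau * e <= \sum_k q k * (expR (tau * b k) - 1)) ->
    e <= \sum_k q k * b k.
  move=> d_le; apply/eqP; rewrite eq_le le_der //= -lerN2 -sumrN.
  under eq_bigr do rewrite -mulrN.
  apply: le_der => tau; rewrite mulrN -mulNr; apply: (le_trans (d_le (- tau))).
  by under eq_bigr do rewrite mulNr -mulrN.
move=> e_le.
(* Divide by tau = 1 / (n + 1) and let n tend to infinity. *)
have e_le_har n : e <= \sum_k q k * (b k * expR (harmonic n * b k)).
  have hn : 0 < (@harmonic R n) by exact: harmonic_gt0.
  rewrite -(ler_pM2l hn) (le_trans (e_le _)) // mulr_sumr ler_sum // => k _.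
  rewrite mulrCA ler_wpM2l //.
  (* exp v - 1 <= v * exp v, from 1 - v <= exp (- v) *)
  set v := harmonic n * b k.
  have -> : harmonic n * (b k * expR v) = v * expR v by rewrite mulrA.
  have := expR_ge1Dx (- v); rewrite expRN => h.
  have := ler_wpM2r (expR_ge0 v) h.
  by rewrite mulVf ?gt_eqF ?expR_gt0 // => h'; lra.
have -> : \sum_k q k * b k = \sum_k q k * (b k * expR (0 * b k)).
  by apply: eq_bigr => k _; rewrite mul0r expR0 mulr1.
apply: (@cvgr_to_ge _ \oo _ _
  (fun n => \sum_k q k * (b k * expR (harmonic n * b k)))); last first.
  by near=> n; exact: e_le_har.
apply: cvg_fin_sum => k; apply: cvgMr; apply: cvgMr.
apply: (cvg_comp _ expR); last exact: continuous_expR.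
by apply: cvgMl; exact: cvg_harmonic.
Unshelve. all: by end_near.
Qed.

Lemma bounded_ultra_cvg (R : realType) (T : Type) (U : set_system T)
    (UU : UltraFilter U) (x : T -> R) (B : R) :
  (forall t, `|x t| <= B) -> exists l : R, x t @[t --> U] --> l.
Proof.
move=> x_le.
have PU := @ultra_proper _ _ UU.
have xB : (x t @[t --> U]) `[- B, B]%classic.
  change (U (x @^-1` `[- B, B]%classic)).
  apply: (filterS _ filterT) => t _ /=.
  by have := x_le t; rewrite ler_norml in_itv.
have [l [_ cl_l]] := @segment_compact R (- B) B _ (fmap_proper_filter x PU) xB.
exists l => A Al.
have [//|UnA] := in_ultra_setVsetC (x @^-1` A) UU.
by have [y []] := cl_l (~` A) A UnA Al.
Qed.

(** * Block coordinate ascent on a subspace *)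

Section BlockAscent.
Variables (R : realType) (K I : finType) (b c : K -> R).

(** The concave objective: a linear form minus a combination of exponentials. *)
Definition expsum (u : K -> R) : R := \sum_k (b k * u k - c k * expR (u k)).

Lemma expsumD (z w : K -> R) :
  expsum (fun k => z k + w k) - expsum z =
  \sum_k b k * w k - \sum_k c k * expR (z k) * (expR (w k) - 1).
Proof.
rewrite /expsum -!sumrB; apply: eq_bigr => k _.
by rewrite expRD; ring.
Qed.

(** The linear forms [b] and [q] agree on [V].  For [q k = c k * expR (z k)]
    this says that the gradient of [expsum] at [z] vanishes on [V]. *)
Definition stationary (V : set (K -> R)) (q : K -> R) : Prop :=
  forall w, V w -> \sum_k b k * w k = \sum_k q k * w k.

Hypothesis c_ge0 : forall k, 0 <= c k.

Lemma maximal_stationary (V : set (K -> R)) (z : K -> R) :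
  (forall a w, V w -> V (fun k => a * w k)) ->
  (forall w, V w -> expsum (fun k => z k + w k) <= expsum z) ->
  stationary V (fun k => c k * expR (z k)).
Proof.
move=> V_scale z_max w Vw; apply: expR_sum_stationary => [k|tau].
  by rewrite mulr_ge0 ?expR_ge0.
have := z_max _ (V_scale tau _ Vw); rewrite -subr_le0 expsumD subr_le0.
by apply: le_trans; rewrite mulr_sumr ler_sum // => k _; rewrite mulrCA.
Qed.

(** Concavity: a stationary point is a maximizer. *)
Lemma stationary_maximal (V : set (K -> R)) (z w : K -> R) :
  stationary V (fun k => c k * expR (z k)) -> V w ->
  expsum (fun k => z k + w k) <= expsum z.
Proof.
move=> st Vw; rewrite -subr_le0 expsumD st // -sumrB sumr_le0 // => k _.
rewrite -mulrBr mulr_ge0_le0 ?mulr_ge0 ?expR_ge0 //.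
by have := expR_ge1Dx (w k); lra.
Qed.

(** The gain is a sum of the Bregman divergences
    [c * (exp z - exp z' - exp z' * (z - z'))], and each of these dominates
    [c * (exp (z / 2) - exp (z' / 2)) ^ 2] because
    [exp ((z - z') / 2) >= 1 + (z - z') / 2]. *)
Lemma expsum_gain (V : set (K -> R)) (z z' : K -> R) :
  stationary V (fun k => c k * expR (z' k)) -> V (fun k => z k - z' k) ->
  \sum_k c k * (expR (z k / 2) - expR (z' k / 2)) ^+ 2 <=
  expsum z' - expsum z.
Proof.
move=> st Vzz.
have := expsumD z' (fun k => z k - z' k).
rewrite (_ : (fun k => _) = z); last first.
  by apply/funext => k; rewrite addrC subrK.
rewrite st // => /(congr1 -%R); rewrite opprB => ->.
rewrite opprB -sumrB ler_sum // => k _.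
rewrite -!mulrA -mulrBr ler_wpM2l //.
set s := expR (z k / 2); set s' := expR (z' k / 2).
have ss : expR (z k) = s * s by rewrite -expRD -splitr.
have ss' : expR (z' k) = s' * s' by rewrite -expRD -splitr.
have ssE : expR (z' k) * (expR (z k - z' k) - 1) = s * s - s' * s'.
  by rewrite mulrBr -expRD mulr1 [z' k + _]addrC subrK ss ss'.
have s_ge : s' * (1 + (z k - z' k) / 2) <= s.
  rewrite (_ : s = s' * expR ((z k - z' k) / 2)).
    by rewrite ler_wpM2l ?expR_ge0 ?expR_ge1Dx.
  by rewrite -expRD; congr expR; lra.
have s'_ge0 : 0 <= s' by exact: expR_ge0.
rewrite ssE ss'; have := ler_wpM2l s'_ge0 s_ge; nra.
Qed.

(** [W] is the feasible subspace, [Wb i] the directions of block [i], [u] the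
    sequence of iterates and [sched t] the block updated between [u t] and
    [u t.+1]; every block is updated within any [N] consecutive steps. *)
Variables (W : set (K -> R)) (Wb : I -> set (K -> R)).
Hypotheses (W_lin : lin_closed W)
  (Wb_scale : forall i a w, Wb i w -> Wb i (fun k => a * w k))
  (W_dec : forall u, W u -> exists2 w : I -> K -> R,
     forall i, Wb i (w i) & u = fun k => \sum_i w i k)
  (W_bounded : forall m, exists B : R, forall u, W u -> m <= expsum u ->
     forall k, `|u k| <= B).

Lemma stationary_blocks (q : K -> R) :
  (forall i, stationary (Wb i) q) -> stationary W q.
Proof.
move=> st u /W_dec[w Ww ->].
under eq_bigr do rewrite mulr_sumr.
rewrite exchange_big /=; under [RHS]eq_bigr do rewrite mulr_sumr.
by rewrite [RHS]exchange_big; apply: eq_bigr => i _; exact: st.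
Qed.

Variables (u : nat -> K -> R) (sched : nat -> I) (N : nat).
Hypotheses (Wu : forall t, W (u t))
  (u_step : forall t, Wb (sched t) (fun k => u t k - u t.+1 k))
  (u_max : forall t w, Wb (sched t) w ->
     expsum (fun k => u t.+1 k + w k) <= expsum (u t.+1))
  (sched_cyclic : forall i t, exists2 s, (s < N)%N & sched (t + s)%N = i).

Let q t k := c k * expR (u t k).

Let q_stationary t : stationary (Wb (sched t)) (q t.+1).
Proof. by apply: maximal_stationary; [exact: Wb_scale|exact: u_max]. Qed.

Let gain t : \sum_k c k * (expR (u t k / 2) - expR (u t.+1 k / 2)) ^+ 2 <=
  expsum (u t.+1) - expsum (u t).
Proof. exact: expsum_gain (@q_stationary t) (u_step t). Qed.

Let expsum_nondecreasing : nondecreasing_seq (fun t => expsum (u t)).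
Proof.
apply/nondecreasing_seqP => t; rewrite -subr_ge0 (le_trans _ (gain t)) //.
by apply: sumr_ge0 => k _; rewrite mulr_ge0 ?sqr_ge0.
Qed.

Let u_bounded : exists B : R, forall t k, `|u t k| <= B.
Proof.
have [B uB] := W_bounded (expsum (u 0%N)).
by exists B => t; apply: uB => //; exact: expsum_nondecreasing.
Qed.

Let expsum_cvg : cvgn (fun t => expsum (u t)).
Proof.
have [B uB] := u_bounded.
apply: nondecreasing_is_cvgn => //.
exists (\sum_k `|b k| * B) => _ [t _ <-]; apply: ler_sum => k _.
rewrite -[leRHS]subr0 lerB ?mulr_ge0 ?expR_ge0 //.
by rewrite (le_trans (ler_norm _)) // normrM ler_wpM2l.
Qed.

Let q_step k : q t.+1 k - q t k @[t --> \oo] --> 0.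
Proof.
have [B uB] := u_bounded.
pose C := c k * (4 * expR B).
have C_ge0 : 0 <= C by rewrite !mulr_ge0 ?expR_ge0.
have q_le t : `|q t.+1 k - q t k| <=
    Num.sqrt (C * (expsum (u t.+1) - expsum (u t))).
  rewrite -sqrtr_sqr ler_wsqrtr //.
  apply: le_trans (ler_wpM2l C_ge0 (gain t)).
  (* c^2 (s^2 - s'^2)^2 = c^2 (s - s')^2 (s + s')^2, and s, s' <= exp (B / 2) *)
  rewrite (bigD1 k) //= mulrDr.
  apply: ler_wpDr.
    by rewrite mulr_ge0 // sumr_ge0 // => j _; rewrite mulr_ge0 ?sqr_ge0.
  rewrite /q /C; set s := expR (u t k / 2); set s' := expR (u t.+1 k / 2).
  have ss : expR (u t k) = s * s by rewrite -expRD -splitr.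
  have ss' : expR (u t.+1 k) = s' * s' by rewrite -expRD -splitr.
  have s_ge0 : 0 <= s by exact: expR_ge0.
  have s'_ge0 : 0 <= s' by exact: expR_ge0.
  have ssB : s * s <= expR B.
    by rewrite -ss ler_expR (le_trans (ler_norm _)).
  have ssB' : s' * s' <= expR B.
    by rewrite -ss' ler_expR (le_trans (ler_norm _)).
  have sB : (s + s') ^+ 2 <= 4 * expR B by nra.
  have d_ge0 : 0 <= c k ^+ 2 * (s - s') ^+ 2 by rewrite mulr_ge0 ?sqr_ge0.
  have := ler_wpM2l d_ge0 sB; rewrite ss ss'.
  by congr (_ <= _); ring.
apply: norm_cvg0.
apply: (@squeeze_cvgr _ _ _ _ (fun=> 0)); [|exact: cvg_cst|].
  by near=> t; rewrite normr_ge0; exact: q_le.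
have -> : 0 = Num.sqrt (C * (limn (fun t => expsum (u t)) -
                             limn (fun t => expsum (u t)))) :> R.
  by rewrite subrr mulr0 sqrtr0.
apply: (cvg_comp _ (@Num.sqrt R)); last exact: sqrt_continuous.
apply: cvgMr; apply: cvgB => //.
by rewrite (cvg_shiftS (fun t => expsum (u t))).
Unshelve. all: by end_near.
Qed.

Let q_shift m k : q (t + m)%N k - q t k @[t --> \oo] --> 0.
Proof.
elim: m => [|m IHm].
  by under eq_cvg do rewrite addn0 subrr; exact: cvg_cst.
have -> : (fun t => q (t + m.+1)%N k - q t k) =
    (fun t => (q (t + m).+1 k - q (t + m)%N k) + (q (t + m)%N k - q t k)).
  by apply/funext => t; rewrite addnS addrA subrK.
rewrite -[0]addr0; apply: cvgD => //.
exact: (cvg_comp _ _ (cvg_addnr m) (q_step k)).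
Qed.

(** Block coordinate ascent converges in value to the maximum of the objective
    on [W], which is attained. *)
Lemma block_ascent_cvg : exists z, [/\ W z,
  forall v, W v -> expsum v <= expsum z &
  expsum (u t) @[t --> \oo] --> expsum z].
Proof.
have [B uB] := u_bounded.
have [U [UU oo_U]] := ultraFilterLemma (_ : ProperFilter \oo).
have PU := @ultra_proper _ _ UU.
have /choice[z uz] : forall k, exists l : R, u t k @[t --> U] --> l.
  by move=> k; apply: bounded_ultra_cvg (uB^~ k).
have cvg_oo_U (g : nat -> R) (l : R) :
    g t @[t --> \oo] --> l -> g t @[t --> U] --> l.
  by move=> gl; apply: cvg_trans gl; exact: cvg_app.
have lim_eq (g : nat -> R) (l l' : R) :
    g t @[t --> U] --> l -> g t @[t --> U] --> l' -> l = l'.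
  by move=> gl gl'; rewrite -(cvg_lim _ gl) // -(cvg_lim _ gl').
have qz k : q t k @[t --> U] --> c k * expR (z k).
  apply: cvgMr; apply: (cvg_comp _ expR); first exact: uz.
  exact: continuous_expR.
have Wz : W z.
  have [C CP] := lin_closed_ker W_lin; apply/CP => l.
  apply: (@lim_eq (fun t => \sum_k u t k * C l k) _ _).
    by apply: cvg_fin_sum => k; exact: cvgMl.
  under eq_cvg do rewrite (proj1 (CP _) (Wu _)).
  exact: cvg_cst.
have st : stationary W (fun k => c k * expR (z k)).
  apply: stationary_blocks => i w Ww.
  (* Block i is updated at time t + s t, hence q is stationary on Wb i just
     after it. *)
  have [s s_lt s_i] : exists2 s : nat -> nat,
      forall t, (s t < N)%N & forall t, sched (t + s t)%N = i.
    have /choice[s sP] : forall t, exists r, (r < N)%N /\ sched (t + r)%N = i.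
      by move=> t; have [r] := sched_cyclic i t; exists r.
    by exists s => t; case: (sP t).
  have qs k : q (t + s t).+1 k - q t k @[t --> \oo] --> 0.
    apply: norm_cvg0.
    apply: (@squeeze_cvgr _ _ _ _ (fun=> 0)
      (fun t => \sum_(r < N) `|q (t + r.+1)%N k - q t k|)).
    - near=> t; rewrite normr_ge0 /=.
      rewrite (bigD1 (Ordinal (s_lt t))) //= -addnS lerDl.
      by rewrite sumr_ge0.
    - exact: cvg_cst.
    - have /cvg_fin_sum : forall r : 'I_N,
          `|q (t + r.+1)%N k - q t k| @[t --> \oo] --> (0 : R).
        by move=> r; rewrite -(normr0 R); apply: cvg_norm; exact: q_shift.
      by rewrite big1.
  apply: (@lim_eq (fun t => \sum_k q (t + s t).+1 k * w k) _ _).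
    under eq_cvg => t.
      rewrite -(@q_stationary (t + s t)%N) ?s_i //.
      over.
    exact: cvg_cst.
  apply: cvg_fin_sum => k; apply: cvgMl.
  have -> : (fun t => q (t + s t).+1 k) =
      (fun t => (q (t + s t).+1 k - q t k) + q t k).
    by apply/funext => t; rewrite subrK.
  by rewrite -[c k * _]add0r; apply: cvgD => //; exact: cvg_oo_U.
exists z; split => //.
  move=> v Wv.
  have -> : v = fun k => z k + (v k - z k).
    by apply/funext => k; rewrite addrC subrK.
  apply: stationary_maximal st _.
  rewrite (_ : (fun k => _) = fun k => -1 * z k + v k).
    by case: W_lin => _; exact.
  by apply/funext => k; rewrite mulN1r addrC.
(* The values converge along the whole sequence, so the limit can be computed
   along U. *)
suff <- : limn (fun t => expsum (u t)) = expsum z by [].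
apply: (@lim_eq (fun t => expsum (u t)) _ _); first exact: cvg_oo_U.
apply: cvg_fin_sum => k; apply: cvgB; last exact: qz.
by apply: cvgMr; exact: uz.
Unshelve. all: by end_near.
Qed.

End BlockAscent.

(** * Edge potentials of dual points *)

Section EdgePotentials.
Variables (R : realType) (n : nat) (Omega : 'I_n -> finType).
Variables (E : {set 'I_n * 'I_n}).
Variables (f : forall i j : 'I_n, Omega i -> Omega j -> R) (eps : R).
Implicit Types (p q d : dual_point R Omega) (i j : 'I_n).

(** An ordered pair of vertices with a label at each end.  Pairs outside [E] are
    kept, with zero potential and zero coefficients. *)
Definition edge_index : finType :=
  {e : 'I_n * 'I_n & (Omega e.1 * Omega e.2)%type}.

(** The scaled potential [(rho_ij(x) + rho_ji(y)) / eps] of an edge. *)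
Definition potential p (k : edge_index) : R :=
  if tag k \in E then
    (rho_e p (tag k).1 (tag k).2 (tagged k).1 +
     rho_e p (tag k).2 (tag k).1 (tagged k).2) / eps
  else 0.

Definition zero_point : dual_point R Omega :=
  DualPoint (fun=> 0) (fun _ _ _ => 0).

(** The point [a * p + q]. *)
Definition comb a p q : dual_point R Omega :=
  DualPoint (fun i => a * rho_v p i + rho_v q i)
            (fun i j x => a * rho_e p i j x + rho_e q i j x).

(** The point [p] with every block other than that of [i] set to zero. *)
Definition restrict i p : dual_point R Omega :=
  DualPoint (fun k => if k == i then rho_v p k else 0)
            (fun k j x => if k == i then rho_e p k j x else 0).

Lemma feasible_zero : feasible E zero_point.
Proof. by move=> i x; rewrite big1. Qed.

Lemma feasible_comb a p q :
  feasible E p -> feasible E q -> feasible E (comb a p q).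
Proof.
by move=> Fp Fq i x; rewrite big_split -mulr_sumr Fp Fq.
Qed.

Lemma feasible_restrict i p : feasible E p -> feasible E (restrict i p).
Proof.
by move=> Fp k x /=; case: ifP => _; [exact: Fp|rewrite big1].
Qed.

Lemma potential_zero : potential zero_point = fun=> 0.
Proof.
by apply/funext => k; rewrite /potential addr0 mul0r; case: ifP.
Qed.

Lemma potential_comb a p q :
  potential (comb a p q) = fun k => a * potential p k + potential q k.
Proof.
apply/funext => k; rewrite /potential /=; case: ifP => _; last by ring.
by ring.
Qed.

Lemma potential_restrict_comb i a p q :
  potential (restrict i (comb a p q)) =
  fun k => a * potential (restrict i p) k + potential (restrict i q) k.
Proof.
rewrite -potential_comb; apply/funext => k; rewrite /potential /=.
case: ifP => // _.
by case: ifP => _; case: ifP => _; rewrite ?mulr0 ?addr0.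
Qed.

Lemma potential_sum_restrict p :
  potential p = fun k => \sum_i potential (restrict i p) k.
Proof.
apply/funext => k; rewrite /potential; case: ifP => _; last by rewrite big1.
have pick (i0 : 'I_n) (v : R) : \sum_i (if i0 == i then v else 0) = v.
  by rewrite -big_mkcond (big_pred1 i0) // => i; rewrite eq_sym.
by rewrite -mulr_suml big_split /= !pick.
Qed.

Lemma potential_block_diff i p q : same_off_block E i p q ->
  potential (restrict i (comb (-1) q p)) =
  fun k => potential p k - potential q k.
Proof.
move=> pq; apply/funext => k; rewrite /potential.
case: ifP => kE; last by rewrite subr0.
have nbr1 : (tag k).2 \in nbr E (tag k).1.
  by rewrite inE -surjective_pairing kE.
have nbr2 : (tag k).1 \in nbr E (tag k).2.
  by rewrite inE -surjective_pairing kE orbT.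
rewrite /= -mulrBl; congr (_ / _).
case: eqVneq => [_|/pq[_ /(_ _ nbr1) ->]];
  by case: eqVneq => [_|/pq[_ /(_ _ nbr2) ->]]; ring.
Qed.

Lemma block_update_feasible i p q :
  feasible E p -> block_update E f eps i p q -> feasible E q.
Proof.
move=> Fp [pq qi _] k; have [->//|ki] := eqVneq k i.
move=> x; have [-> pqk] := pq k ki; rewrite -(Fp k x).
by apply: eq_bigr => j jk; exact: pqk.
Qed.

(** * The objective as a function of the edge potentials *)

Hypothesis E_lt : forall i j, (i, j) \in E -> (i < j)%N.

(** Handshake: each edge is seen once from either end, since [E] never contains
    both orientations. *)
Lemma sum_nbr (G : 'I_n -> 'I_n -> R) :
  \sum_i \sum_(j in nbr E i) G i j = \sum_(e in E) (G e.1 e.2 + G e.2 e.1).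
Proof.
have -> : \sum_i \sum_(j in nbr E i) G i j =
    \sum_i \sum_j ((if (i, j) \in E then G i j else 0) +
                   (if (j, i) \in E then G i j else 0)).
  apply: eq_bigr => i _; rewrite big_mkcond; apply: eq_bigr => j _.
  rewrite inE; case ij: ((i, j) \in E); case ji: ((j, i) \in E);
    rewrite ?addr0 ?add0r //.
  by have := ltn_trans (E_lt ij) (E_lt ji); rewrite ltnn.
under eq_bigr do rewrite big_split /=.
rewrite big_split /= [X in _ + X]exchange_big !pair_big -big_split.
rewrite [RHS]big_mkcond /=.
apply: eq_bigr => -[i j] _ /=.
by case: ifP; rewrite ?addr0.
Qed.

(** The constraints, read along a configuration [x]. *)
Lemma sum_rho_v p (x : forall i, Omega i) : feasible E p ->
  \sum_i rho_v p i =
  \sum_(e in E) (rho_e p e.1 e.2 (x e.1) + rho_e p e.2 e.1 (x e.2)).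
Proof.
move=> Fp; rewrite -(sum_nbr (fun i j => rho_e p i j (x i))).
by apply: eq_bigr => i _; rewrite Fp.
Qed.

Lemma sum_edge_index
    (G : forall e : 'I_n * 'I_n, Omega e.1 -> Omega e.2 -> R) :
  \sum_(e in E) \sum_x \sum_y G e x y =
  \sum_(k : edge_index)
    if tag k \in E then G (tag k) (tagged k).1 (tagged k).2 else 0.
Proof.
rewrite -big_mkcond (eq_bigr (fun e =>
  \sum_(z : Omega e.1 * Omega e.2) G e z.1 z.2)); last first.
  by move=> e _; rewrite pair_big.
rewrite (sig_big_dep _ _ (fun e (z : Omega e.1 * Omega e.2) => G e z.1 z.2)).
by apply: eq_bigl => k; rewrite andbT.
Qed.

(** Coefficients of the linear part of the objective, for a chosen
    configuration [x]: on potentials of feasible points this linear form does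
    not depend on [x]. *)
Definition lin_coeff (x : forall i, Omega i) (k : edge_index) : R :=
  ((tag k \in E) && (tagged k == (x (tag k).1, x (tag k).2)))%:R.

(** Coefficients of the exponentials of the potentials. *)
Definition exp_coeff (k : edge_index) : R :=
  if tag k \in E then
    expR (- (f (tagged k).1 (tagged k).2 / eps + 1))
  else 0.

Hypothesis eps_gt0 : 0 < eps.

Lemma objectiveE p (x : forall i, Omega i) : feasible E p ->
  objective E f eps p =
  eps * expsum (lin_coeff x) exp_coeff (potential p).
Proof.
move=> Fp; rewrite /expsum sumrB mulrBr; congr (_ - _).
  rewrite (sum_rho_v x Fp) mulr_sumr.
  under [RHS]eq_bigr => k _.
    rewrite (_ : eps * _ = if tag k \in E then
      (tagged k == (x (tag k).1, x (tag k).2))%:R *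
      (rho_e p (tag k).1 (tag k).2 (tagged k).1 +
       rho_e p (tag k).2 (tag k).1 (tagged k).2) else 0); last first.
      rewrite /lin_coeff /potential; case: ifP => _; last by rewrite !mulr0.
      by rewrite /= mulrCA [eps * _]mulrC divfK ?gt_eqF.
    over.
  rewrite -(sum_edge_index (fun e y z => ((y, z) == (x e.1, x e.2))%:R *
    (rho_e p e.1 e.2 y + rho_e p e.2 e.1 z))).
  apply: eq_bigr => e _; rewrite pair_big (bigD1 (x e.1, x e.2)) //= eqxx mul1r.
  by rewrite big1 ?addr0 // => -[y z] /= /negbTE ->; rewrite mul0r.
congr (eps * _).
rewrite (sum_edge_index (fun e y z => expR
  ((rho_e p e.1 e.2 y + rho_e p e.2 e.1 z - f y z) / eps - 1))).
apply: eq_bigr => k _; rewrite /exp_coeff /potential.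
case: ifP => _; last by rewrite mul0r.
by rewrite -expRD; congr expR; ring.
Qed.

Lemma expR_ge_double (v : R) : 2 * v <= expR v.
Proof.
have [v_le0|v_gt0] := leP v 0.
  by rewrite (le_trans _ (expR_ge0 v)) //; lra.
have -> : expR v = expR (v / 2) ^+ 2 by rewrite expr2 -expRD -splitr.
set s := expR (v / 2); have s_ge : 1 + v / 2 <= s by exact: expR_ge1Dx.
have := sqr_ge0 (1 - v / 2); rewrite !expr2; nra.
Qed.

(** On feasible points, superlevel sets of the objective are bounded in the edge
    potentials. *)
Lemma potential_bounded (x0 : forall i, Omega i) (m : R) :
  exists B : R, forall p, feasible E p ->
    m <= expsum (lin_coeff x0) exp_coeff (potential p) ->
    forall k, `|potential p k| <= B.
Proof.
pose g (k : edge_index) := f (tagged k).1 (tagged k).2 / eps + 1.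
pose S := \sum_k `|g k|.
have S_ge0 : 0 <= S by exact: sumr_ge0.
exists (`|m| + 3 * S) => p Fp m_le k.
have [kE|kNE] := boolP (tag k \in E); last first.
  by rewrite /potential (negbTE kNE) normr0 addr_ge0 // mulr_ge0.
(* A configuration through the two labels of k, in place of x0, makes the
   coefficient of potential p k equal to 1. *)
have [x xk] : exists x : forall i, Omega i,
    tagged k = (x (tag k).1, x (tag k).2).
  have k12 : (tag k).1 != (tag k).2.
    rewrite -(inj_eq val_inj) /= ltn_eqF //; apply: E_lt.
    by rewrite -surjective_pairing.
  exists (eqtype.dfwith (eqtype.dfwith x0 (tagged k).1) (tagged k).2).
  rewrite eqtype.dfwith_in eqtype.dfwith_out; last by rewrite eq_sym.
  by rewrite eqtype.dfwith_in -surjective_pairing.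
have {}m_le : m <= expsum (lin_coeff x) exp_coeff (potential p).
  have /(mulfI (lt0r_neq0 eps_gt0)) <- := etrans (esym (objectiveE x0 Fp))
    (objectiveE x Fp).
  exact: m_le.
(* v - exp (v - g) <= g - 1, from exp w >= 1 + w *)
have term_le l : lin_coeff x l * potential p l -
    exp_coeff l * expR (potential p l) <= `|g l|.
  rewrite /lin_coeff /exp_coeff -/(g l); case: ifPn => lE /=; last first.
    by rewrite !mul0r subr0.
  rewrite -expRD; have := expR_ge0 (- g l + potential p l).
  have := expR_ge1Dx (- g l + potential p l).
  have := ler_norm (g l); have := normr_ge0 (g l).
  by case: eqP => _; rewrite ?mul1r ?mul0r; lra.
have {}m_le : m <= potential p k - expR (- g k + potential p k) + S.
  apply: (le_trans m_le); rewrite /expsum (bigD1 k) //=; apply: lerD.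
    by rewrite /lin_coeff /exp_coeff kE -xk eqxx mul1r -expRD.
  rewrite /S [leRHS](bigD1 k) //=; apply: ler_wpDl => //.
  by apply: ler_sum => l _.
have gS : `|g k| <= S by rewrite /S (bigD1 k) //= lerDl sumr_ge0.
(* The term of k is at most potential p k, and at most
   2 * g k - potential p k. *)
have := expR_ge_double (- g k + potential p k).
have := expR_ge0 (- g k + potential p k).
have := ler_norm (g k); have := ler_norm m; have := ler_norm (- m).
rewrite normrN ler_norml => *; apply/andP; split; lra.
Qed.

End EdgePotentials.

(** * Convergence of the block coordinate ascent *)

Theorem mainTheorem10 (R : realType) (n : nat)
    (Omega : 'I_n -> finType) (Omega_neq0 : forall i : 'I_n, (0 < #|Omega i|)%N)
    (E : {set 'I_n * 'I_n})
    (E_lt : forall i j : 'I_n, (i, j) \in E -> (i < j)%N)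
    (f : forall i j : 'I_n, Omega i -> Omega j -> R)
    (eps : R) (eps_gt0 : 0 < eps)
    (order : {perm 'I_n}) (p : nat -> dual_point R Omega)
    (p_bca : block_coordinate_ascent E f eps order p) :
  exists M : R,
    is_maximal_value E f eps M /\
    objective E f eps (p t) @[t --> \oo] --> M.
Proof.
have [n_gt0|n0] := ltnP 0 n; last first.
  have obj0 q : objective E f eps q = 0.
    have no_vertex (i : 'I_n) : False.
      by have := leq_trans (ltn_ord i) n0; rewrite ltn0.
    rewrite /objective big1; last by move=> i; case: (no_vertex i).
    by rewrite big1 ?mulr0 ?subr0 // => -[i]; case: (no_vertex i).
  exists 0; split; last by under eq_cvg do rewrite obj0; exact: cvg_cst.
  by split=> [|q _]; [exists (p 0%N) => //; exact: p_bca.1|rewrite obj0].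
have x0 i : Omega i := enum_val (Ordinal (Omega_neq0 i)).
pose sched t := order (Ordinal (ltn_pmod t n_gt0)).
have p_update t : block_update E f eps (sched t) (p t) (p t.+1).
  by have := p_bca.2 (t %/ n)%N (Ordinal (ltn_pmod t n_gt0)); rewrite -divn_eq.
have p_feasible t : feasible E (p t).
  elim: t => [|t IHt]; first exact: p_bca.1.
  exact: block_update_feasible IHt (p_update t).
have sched_cyclic i t : exists2 s, (s < n)%N & sched (t + s)%N = i.
  pose k := (order^-1)%g i.
  exists ((k + (n - t %% n)) %% n)%N; first by rewrite ltn_pmod.
  rewrite /sched (_ : Ordinal _ = k) ?permKV //; apply: val_inj => /=.
  rewrite modnDmr -modnDml addnCA subnKC; last by rewrite ltnW ?ltn_pmod.
  by rewrite modnDr modn_small.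
(* The potentials of the feasible points, and the directions of each block. *)
pose W : set (edge_index Omega -> R) :=
  [set u | exists2 q, feasible E q & u = potential E eps q].
pose Wb i : set (edge_index Omega -> R) :=
  [set u | exists2 q, feasible E q & u = potential E eps (restrict i q)].
have c_ge0 k : 0 <= exp_coeff E f eps k.
  by rewrite /exp_coeff; case: ifP => // _; exact: expR_ge0.
have W_lin : lin_closed W.
  split.
    exists (zero_point R Omega); first exact: feasible_zero.
    by rewrite potential_zero.
  move=> a _ _ [q1 F1 ->] [q2 F2 ->].
  exists (comb a q1 q2); first exact: feasible_comb.
  by rewrite potential_comb.
have Wb_scale i a w : Wb i w -> Wb i (fun k => a * w k).
  move=> [q Fq ->]; (* a * q = (a - 1) * q + q *)
  exists (comb (a - 1) q q); first exact: feasible_comb.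
  by rewrite potential_restrict_comb; apply/funext => k; ring.
have W_dec u : W u -> exists2 w : 'I_n -> edge_index Omega -> R,
    forall i, Wb i (w i) & u = fun k => \sum_i w i k.
  move=> [q Fq ->]; exists (fun i => potential E eps (restrict i q)).
    by move=> i; exists q.
  exact: potential_sum_restrict.
have W_bounded (m : R) : exists B : R, forall u, W u ->
    m <= expsum (lin_coeff R E x0) (exp_coeff E f eps) u ->
    forall k, `|u k| <= B.
  have [B pB] := potential_bounded f E_lt eps_gt0 x0 m.
  by exists B => _ [q Fq ->]; exact: pB.
have [|||z [[q Fq zq] z_max z_cvg]] := block_ascent_cvg
  c_ge0 W_lin Wb_scale W_dec W_bounded (u := fun t => potential E eps (p t))
  (sched := sched) _ _ _ sched_cyclic.
- by move=> t; exists (p t).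
- move=> t; have [off _ _] := p_update t.
  exists (comb (-1) (p t.+1) (p t)); first exact: feasible_comb.
  by rewrite (potential_block_diff _ off).
- move=> t _ [d Fd ->]; have [off _ p_max] := p_update t.
  pose q := comb 1 (restrict (sched t) d) (p t.+1).
  have Fq : feasible E q.
    by apply: feasible_comb => //; exact: feasible_restrict.
  have off_q : same_off_block E (sched t) (p t) q.
    move=> k ki; have [pv pe] := off k ki; rewrite /= (negbTE ki).
    split=> [|j jk x]; first by rewrite mulr0 add0r.
    by rewrite mulr0 add0r pe.
  have := p_max q off_q (Fq _).
  rewrite !(objectiveE f E_lt eps_gt0 x0) // ler_pM2l // potential_comb.
  apply: le_trans; rewrite le_eqVlt; apply/orP; left; apply/eqP.
  by congr expsum; apply/funext => k; rewrite mul1r addrC.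
exists (eps * expsum (lin_coeff R E x0) (exp_coeff E f eps) z); split.
  split; first by exists q; rewrite // zq; exact: objectiveE.
  move=> r Fr; rewrite (objectiveE f E_lt eps_gt0 x0 Fr) ler_pM2l //.
  by apply: z_max; exists r.
under eq_cvg do rewrite (objectiveE f E_lt eps_gt0 x0 (p_feasible _)).
by apply: cvgMr.
Qed.
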